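(* Let $\Sigma\subset\mathbb{T}^3=\mathbb{R}^3/\mathbb{Z}^3$ be a compact regular toral surface of finite area $A$ which admits a smooth normal vector locally. The integral $$\mathcal{I}=\mathcal{I}_\Sigma:=\iint_{\Sigma^2}\langle\overrightarrow{n}(\sigma),\overrightarrow{n}(\sigma')\rangle^2\,d\sigma\, d\sigma',$$ where $\overrightarrow{n}(\sigma)$ is the unit normal vector to $\Sigma$ at $\sigma$, satisfies the sharp bounds $$\frac{A^2}{3}\leq\mathcal{I}\leq A^2,$$ so that $$0\leq\frac{\pi^2}{60}(3\mathcal{I}-A^2)\leq\frac{\pi^2}{30}A^2.$$
   Context: A regular surface is a smooth $2$-dimensional submanifold of $\mathbb{T}^3$, possibly with boundary; $d\sigma$ is surface area measure on $\Sigma$. ''Sharp'' means that the constants $1/3$ and $1$ cannot be improved over the class of all such surfaces. *)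

(* Defs.v *)
From HB Require Import structures.
From mathcomp Require Import all_boot all_order all_algebra.
From mathcomp Require Import archimedean.
From mathcomp Require Import all_classical all_reals all_analysis.
Set Implicit Arguments.
Unset Strict Implicit.
Unset Printing Implicit Defensive.
Import Order.TTheory GRing.Theory Num.Theory.
Import numFieldNormedType.Exports.
Local Open Scope classical_set_scope.
Local Open Scope ring_scope.
Local Open Scope quotient_scope.

Section Torus.
Context (R : realType).

Definition lattice_rel : rel 'rV[R]_3 :=
  fun x y => [forall i, (x 0 i - y 0 i) \is a Num.int].

Lemma lattice_rel_refl : reflexive lattice_rel.
Proof. by move=> x; apply/forallP => i; rewrite subrr rpred0. Qed.

Lemma lattice_rel_sym : symmetric lattice_rel.
Proof. by move=> x y; apply: eq_forallb => i; rewrite -opprB rpredN. Qed.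

Lemma lattice_rel_trans : transitive lattice_rel.
Proof.
move=> y x z /forallP xy /forallP yz; apply/forallP => i.
by rewrite -(subrKA (y 0 i)) rpredD.
Qed.

Definition lattice_equiv : equiv_rel 'rV[R]_3 :=
  EquivRel _ lattice_rel_refl lattice_rel_sym lattice_rel_trans.

Definition torus3 := quotient_topology {eq_quot lattice_equiv}.
HB.instance Definition _ := Topological.on torus3.
HB.instance Definition _ := Quotient.on torus3.
HB.instance Definition _ := Pointed.on torus3.

Definition torus_proj (x : 'rV[R]_3) : torus3 := \pi_torus3 x.

Definition torus3_borel := g_sigma_algebraType (@open torus3).

End Torus.

Section Smooth.
Context (R : realType) (V W : normedModType R).

Fixpoint Ck_on (k : nat) (U : set V) (f : V -> W) : Prop :=
  if k is k'.+1 then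
    (forall x, U x -> differentiable f x) /\
    (forall v, Ck_on k' U (fun x => 'D_v f x))
  else forall x, U x -> {for x, continuous f}.

(* Meant for open U; f is total and its values outside U are irrelevant. *)
Definition smooth_on (U : set V) (f : V -> W) : Prop :=
  forall k, Ck_on k U f.

End Smooth.

Section Surface.
Context (R : realType).
Implicit Types (S : set (torus3 R)) (U : set (R * R)).
Implicit Types (x : R * R -> 'rV[R]_3) (p : torus3 R).

(* The norm of 'rV[R]_3 in the library is the sup norm, so Euclidean lengths
   are expressed through this inner product. *)
Definition dot (v w : 'rV[R]_3) : R := \sum_(i < 3) v 0 i * w 0 i.

Definition half_plane : set (R * R) := [set u | 0 <= u.2].

(* A local parametrization is written as a lift x to R^3 of a map into the
   torus. It is smooth on the open set U and used on U `&` half_plane, so that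
   points of the boundary line of the half-plane give boundary points of S and
   U inside the open half-plane gives an interior chart. The last clause makes
   torus_proj \o x open onto its image, which is relatively open in S; being
   also continuous and injective, it is a homeomorphism onto that image. *)
Definition local_param S U x : Prop :=
  [/\ open U,
      smooth_on U x,
      (forall u, (U `&` half_plane) u -> injective ('d x u)),
      set_inj (U `&` half_plane) (@torus_proj R \o x) &
      forall W : set (R * R), open W ->
        exists2 V : set (torus3 R), open V &
          (@torus_proj R \o x) @` (U `&` half_plane `&` W) = S `&` V].

Definition regular_surface S : Prop :=
  forall p, S p -> exists U x,
    local_param S U x /\ ((@torus_proj R \o x) @` (U `&` half_plane)) p.

Definition tangent_space S p : set 'rV[R]_3 :=
  [set w | exists U x u v, [/\ local_param S U x, (U `&` half_plane) u,
                            torus_proj (x u) = p & w = 'D_v x u]].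

Definition unit_normal S p (nu : 'rV[R]_3) : Prop :=
  dot nu nu = 1 /\ (forall w, tangent_space S p w -> dot nu w = 0).

Definition has_local_smooth_normal S : Prop :=
  forall p, S p -> exists (V : set (torus3 R)) (nu : torus3 R -> 'rV[R]_3),
    [/\ open V, V p,
        smooth_on (@torus_proj R @^-1` V) (nu \o @torus_proj R) &
        forall q, (S `&` V) q -> unit_normal S q (nu q)].

(* The density sqrt(E G - F^2) = |x_u /\ x_v| of the first fundamental form. *)
Definition area_density x (u : R * R) : R :=
  let xu := 'D_(1, 0) x u in
  let xv := 'D_(0, 1) x u in
  Num.sqrt (dot xu xu * dot xv xv - dot xu xv ^+ 2).

(* sigma is the surface area measure of S, extended by 0 to the torus: it is
   given by the area density in the charts of some atlas of S. By the change of
   variables formula the same then holds in every chart, and sigma is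
   unique. *)
Definition area_measure S
    (sigma : {finite_measure set (torus3_borel R) -> \bar R}) : Prop :=
  sigma (~` S) = 0%E /\
  forall p, S p -> exists U x,
    [/\ local_param S U x,
        ((@torus_proj R \o x) @` (U `&` half_plane)) p &
        forall B : set (torus3_borel R), measurable B ->
          B `<=` (@torus_proj R \o x) @` (U `&` half_plane) ->
          sigma B = (\int[@lebesgue_measure R \x @lebesgue_measure R]_(u in
            U `&` half_plane `&` (@torus_proj R \o x) @^-1` B)
            (area_density x u)%:E)%E].

(* A compact regular toral surface S of finite area with its area measure. The
   field n is a pointwise choice of unit normal on S: no global continuity is
   required, so S may be non-orientable. *)
Definition toral_surface S
    (sigma : {finite_measure set (torus3_borel R) -> \bar R})
    (n : torus3 R -> 'rV[R]_3) : Prop :=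
  [/\ compact S, regular_surface S, has_local_smooth_normal S,
      area_measure S sigma & forall p, S p -> unit_normal S p (n p)].

Definition normal_integral S
    (sigma : {finite_measure set (torus3_borel R) -> \bar R})
    (n : torus3 R -> 'rV[R]_3) : \bar R :=
  (\int[sigma \x sigma]_(z in S `*` S) (dot (n z.1) (n z.2) ^+ 2)%:E)%E.

End Surface.

(* Main.v *)
Require Import Defs.
From HB Require Import structures.
From mathcomp Require Import all_boot all_order all_algebra.
From mathcomp Require Import measurable_realfun ring lra.
From mathcomp Require Import all_classical all_reals all_analysis.
Set Implicit Arguments.
Unset Strict Implicit.
Unset Printing Implicit Defensive.
Import Order.TTheory GRing.Theory Num.Theory.
Import numFieldNormedType.Exports.
Local Open Scope classical_set_scope.
Local Open Scope ring_scope.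

(** The squared inner product is a sum of products of functions of one point:
    [dot n n' ^+ 2] is the sum over [(i, j)] of [(n_i n_j) (n'_i n'_j)].  By
    Fubini the double integral is therefore the squared Frobenius norm of the
    symmetric matrix [M] of moments [M_ij], the integral of [n_i n_j] over the
    surface ([normal_integralE]).  Since [n] is a unit vector, [M] has trace
    [A] ([normal_integral_trace]); keeping only the diagonal of [M] and applying
    the inequality between the sum of three squares and the square of their sum
    gives the lower bound [A ^+ 2 / 3].  The upper bound is Cauchy-Schwarz under
    the integral sign ([normal_integral_bounds]).

    The field [n] is only a pointwise choice and may jump between the two unit
    normals.  The products [n_i n_j] do not see this sign: the tangent space at
    a point contains a plane, so two unit normals at the same point are
    proportional ([unit_normal_prod_unique]), and [n_i n_j] agrees locally with
    the corresponding product for a smooth normal.  Hence it is measurable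
    ([normal_prod_measurable]).

    For sharpness, closed flat surfaces do not suffice, because two disjoint flat
    subtori of the three-torus are parallel; surfaces with boundary do.  Take the
    three flat annuli obtained from one another by cyclically permuting the
    coordinates: one coordinate runs over the circle, the next one over
    [[1/4, 3/4]], and the last one is zero.  They are pairwise disjoint
    ([annulus_disjoint]) and have area [1/2] and mutually orthogonal constant
    normals.  For a union of [m] of them, [A = m / 2] and the integral equals
    [m / 4] ([annuli_area_total], [annuli_normal_integral]): one annulus attains
    the upper bound and three annuli attain the lower one.

    What has to be checked is that these unions are surfaces in the required
    sense.  Charts that start at an edge of the annulus are affine
    ([edge_chart_local_param]); every chart at a point of an annulus has its
    tangent vectors in the plane of that annulus, because its normal coordinate
    takes integer values and is thus locally constant ([tangent_annuli]); and the
    area, defined as the image of the Lebesgue measure of one fundamental band,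
    is recovered in every edge chart by translating and reflecting the plane
    ([annulus_area_chart], [plane_lebesgue_isometry]). *)

(** * The quotient topology of the torus *)

Section TorusTopology.
Context (R : realType).
Implicit Types (x y : 'rV[R]_3) (p q : torus3 R).

Lemma torus_projP x y :
  torus_proj x = torus_proj y <-> forall i, x 0 i - y 0 i \is a Num.int.
Proof.
have h := rwP (@eqmodP _ (lattice_equiv R) x y).
by split=> [eqxy|intxy]; [exact/forallP/h.1|exact/h.2/forallP].
Qed.

Lemma torus_proj_surj p : exists x, torus_proj x = p.
Proof. by exists (repr p); rewrite /torus_proj reprK. Qed.

Lemma torus_proj_continuous : continuous (@torus_proj R).
Proof. exact: pi_continuous. Qed.

Lemma torus_openE (V : set (torus3 R)) : open V = open (@torus_proj R @^-1` V).
Proof. by []. Qed.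

(** The saturation of an open set is the union of its integer translates. *)
Lemma torus_proj_open (O : set 'rV[R]_3) :
  open O -> open (@torus_proj R @` O).
Proof.
move=> oO; rewrite torus_openE.
rewrite (_ : _ @^-1` _ =
  \bigcup_(z in [set z : 'rV[R]_3 | forall i, z 0 i \is a Num.int])
    ((fun x => x - z) @^-1` O)); last first.
  apply/seteqP; split=> [x [y Oy /torus_projP yx]|x [z zint Oxz]] /=.
    exists (x - y) => [i|]; last by rewrite /= subKr.
    by rewrite !mxE -opprB rpredN.
  exists (x - z) => //; apply/torus_projP => i.
  by rewrite !mxE addrAC subrr add0r rpredN.
apply: bigcup_open => z _; apply: open_comp => // x _.
by apply: continuousB; [move=> ?; exact: cvg_id|exact: cst_continuous].
Qed.

Lemma open_torus_ball x e : 0 < e -> open (@torus_proj R @` ball x e).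
Proof. by move=> e0; apply: torus_proj_open; exact: ball_open. Qed.

(** Two points with distinct images differ by a non-integer in some coordinate;
    balls whose radius is a quarter of the distance of that difference to the
    integers have disjoint images. *)
Lemma torus_hausdorff : hausdorff_space (torus3 R).
Proof.
rewrite open_hausdorff => p q.
have [x <-] := torus_proj_surj p; have [y <-] := torus_proj_surj q.
move=> /eqP xy.
have /existsNP [i nint] : ~ forall i, x 0 i - y 0 i \is a Num.int.
  by move/torus_projP.
set d := x 0 i - y 0 i in nint.
pose m : R := (Num.floor d)%:~R.
have md : m < d.
  rewrite lt_neqAle floor_le_tmp andbT; apply/eqP => h.
  by apply: nint; rewrite -h; exact: intr_int.
have dm : d < m + 1 by rewrite /m -intrD1 floorD1_gt.
pose e := Num.min (d - m) (m + 1 - d) / 4.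
have e0 : 0 < e by rewrite divr_gt0// lt_min !subr_gt0 md.
exists (@torus_proj R @` ball x e, @torus_proj R @` ball y e).
  by split; apply/mem_set => /=; [exists x|exists y] => //; exact: ballxx.
split; [exact: open_torus_ball|exact: open_torus_ball|].
apply/eqP; rewrite -subset0 => z [/= [x' [_ xx'] <-] [y' [_ yy']]] /torus_projP /(_ i).
have := xx' 0 i; have := yy' 0 i; rewrite /ball/= => hy hx.
move=> /intrP[k hk].
have h4 : e * 4 <= d - m /\ e * 4 <= m + 1 - d.
  by rewrite /e divfK// !ge_min !lexx orbT.
have b1 : `|- k%:~R - d| < e * 2.
  have -> : - k%:~R - d = (y 0 i - y' 0 i) - (x 0 i - x' 0 i).
    by rewrite -hk /d; ring.
  rewrite mulr_natr mulr2n; apply: le_lt_trans (ler_normB _ _) _.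
  by rewrite ltrD.
have [] : m < - k%:~R /\ - k%:~R < m + 1.
  by move: b1 h4; rewrite ltr_norml => /andP[? ?] [? ?]; split; lra.
rewrite /m -mulrNz -intrD1 !ltr_int ltzD1 => h1 h2.
by move: (lt_le_trans h1 h2); rewrite ltxx.
Qed.

Lemma torus_compact_closed (S : set (torus3 R)) : compact S -> closed S.
Proof. by apply: compact_closed; exact: torus_hausdorff. Qed.

Lemma torus_open_measurable (V : set (torus3_borel R)) :
  @open (torus3 R) V -> measurable V.
Proof. by move=> oV; exact: sub_sigma_algebra. Qed.

(** Compact surfaces are Borel sets because the torus is Hausdorff; this makes
    the integrals over them meaningful. *)
Lemma torus_compact_measurable (S : set (torus3_borel R)) :
  @compact (torus3 R) S -> measurable S.
Proof.
move=> /torus_compact_closed cS; rewrite -(setCK S); apply: measurableC.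
by apply: torus_open_measurable; exact: closed_openC.
Qed.

End TorusTopology.

(** * Measurability and double integrals *)

(** Fubini turns each rank-one kernel [f x * f y] into a square. The
    functions are only controlled on [D], so they are first extended by zero to
    be measurable on the whole space. *)
Lemma integral_kernel_sum d (T : measurableType d) (R : realType)
    (mu : {finite_measure set T -> \bar R}) (D : set T) (K : finType)
    (f : K -> T -> R) : measurable D ->
  (forall k, measurable_fun D (f k)) ->
  (forall k x, D x -> `|f k x| <= 1) ->
  (\int[mu \x mu]_(z in D `*` D) (\sum_k f k z.1 * f k z.2)%:E =
   (\sum_k (\int[mu]_(x in D) f k x)%R ^+ 2)%:E)%E.
Proof.
move=> mD mf f1; pose g k := f k \_ D.
have mg k : measurable_fun [set: T] (g k).
  by apply/(measurable_restrict _ _ _).1 => //; rewrite setTI.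
have g1 k x : `|g k x| <= 1.
  by rewrite /g patchE; case: ifPn => [/set_mem/f1//|_]; rewrite normr0.
have ig k : mu.-integrable [set: T] (EFin \o g k).
  apply: measurable_bounded_integrable => //.
    by rewrite ltey_eq fin_num_measure.
  by exists 1; split => // M M1 x _ /=; exact: le_trans (g1 k x) (ltW M1).
have mgg k : measurable_fun [set: T * T] (fun z => g k z.1 * g k z.2).
  by apply: measurable_funM; apply: measurableT_comp.
have igg k : (mu \x mu)%E.-integrable [set: T * T]
    (EFin \o (fun z => g k z.1 * g k z.2)).
  apply: measurable_bounded_integrable => //.
    rewrite -setXTT [ltLHS]product_measure1E// ltey_eq.
    by rewrite fin_numM// fin_num_measure.
  exists 1; split => // M M1 x _ /=; apply: le_trans (ltW M1).
  by rewrite normrM -[leRHS]mulr1 ler_pM.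
rewrite integral_mkcond.
transitivity (\int[mu \x mu]_z \sum_k
    (EFin \o (fun z : T * T => (g k z.1 * g k z.2)%R)) z)%E.
  apply: eq_integral => z _; rewrite patchE sumEFin; case: ifPn.
    move=> /set_mem[/mem_set D1 /mem_set D2].
    by congr EFin; apply: eq_bigr => k _; rewrite /g !patchE D1 D2.
  rewrite notin_setE => nD; congr EFin; rewrite big1// => k _.
  rewrite /g !patchE; case: ifPn => [/set_mem D1|_]; last by rewrite mul0r.
  by case: ifPn => [/set_mem D2|_]; rewrite ?mulr0//; case: nD.
rewrite integral_sum//= -sumEFin; apply: eq_bigr => k _.
rewrite -integral12_prod_meas1//; last exact: igg.
have gfin : (\int[mu]_x (g k x)%:E)%E = ((\int[mu]_(x in D) f k x)%R)%:E.
  rewrite Rintegral_mkcond /Rintegral fineK//.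
  exact: integrable_fin_num (ig k).
rewrite /fubini_F/=.
under eq_integral do under eq_integral do rewrite EFinM.
under eq_integral => x _ do (rewrite integralZl//; last exact: ig).
rewrite gfin; under eq_integral do rewrite muleC.
by rewrite integralZl//; [rewrite gfin -EFinM|exact: ig].
Qed.

Section LocalMeasurability.
Context (R : realType).

(** Measurability is a local property, without any countability argument: the
    preimage of an open interval is the trace on [S] of one open set, the union
    of all the open sets whose trace is mapped into the interval. *)
Lemma torus_locally_measurable (S : set (torus3_borel R))
    (f : torus3_borel R -> R) : measurable S ->
  (forall p, S p -> exists (V : set (torus3 R)) (g : torus3 R -> R),
    [/\ open V, V p, (forall O, open O -> open (V `&` g @^-1` O)) &
        forall q, S q -> V q -> f q = g q]) ->
  measurable_fun S f.
Proof.
move=> mS loc.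
apply: (measurability _ (RGenOpens.measurableE R)) => _ [_ [a [b ->] <-]].
set O : set R := `]a, b[%classic.
have oO : open O by exact: interval_open.
pose W := \bigcup_(V in [set V : set (torus3 R) | open V /\
                           S `&` V `<=` f @^-1` O]) V.
have -> : S `&` f @^-1` O = S `&` (W : set (torus3_borel R)).
  apply/seteqP; split=> p [Sp]; last first.
    by move=> [V [_ SV] Vp]; split=> //; exact: SV.
  have [V [g [oV Vp Vg fg]]] := loc p Sp => Ofp; split=> //.
  exists (V `&` g @^-1` O); last by split=> //=; rewrite -fg.
  by split=> [|q [Sq [Vq]]]; [exact: Vg|rewrite /= fg].
apply: measurableI => //; apply: torus_open_measurable.
by apply: bigcup_open => V [].
Qed.

End LocalMeasurability.

(** * The matrix of second moments of the normal *)

Section Normals.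
Context (R : realType).
Implicit Types (a b n m : 'rV[R]_3).

Lemma dot_mulmx a b : dot a b = (a *m b^T) 0 0.
Proof. by rewrite mxE; apply: eq_bigr => i _; rewrite mxE. Qed.

(** The orthogonal complement of two independent vectors of the three-space is a
    line, so [n] is plus or minus [m], and the sign cancels in the products. *)
Lemma unit_orthogonal_line a b n m :
  (forall s t : R, s *: a + t *: b = 0 -> s = 0 /\ t = 0) ->
  dot n n = 1 -> dot n a = 0 -> dot n b = 0 ->
  dot m m = 1 -> dot m a = 0 -> dot m b = 0 ->
  forall i j, n 0 i * n 0 j = m 0 i * m 0 j.
Proof.
move=> ind nn na nb mm ma mb.
pose P := col_mx a b : 'M[R]_(1 + 1, 3).
have freeP : row_free P.
  rewrite -kermx_eq0 -submx0; apply/row_subP => r; rewrite submx0.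
  have /eqP : row r (kermx P) *m P = 0 by rewrite -row_mul mulmx_ker row0.
  rewrite -[row r _](@hsubmxK _ 1 1 1) mul_row_col.
  rewrite [lsubmx _]mx11_scalar [rsubmx _]mx11_scalar !mul_scalar_mx.
  by move=> /eqP/ind[-> ->]; rewrite !raddf0 row_mx0.
have kerE v : dot v a = 0 -> dot v b = 0 -> (v <= kermx P^T)%MS.
  move=> va vb; apply/sub_kermxP; rewrite tr_col_mx mul_mx_row.
  rewrite [v *m a^T]mx11_scalar [v *m b^T]mx11_scalar -!dot_mulmx va vb.
  by rewrite !raddf0 row_mx0.
have rk1 : \rank (kermx P^T) = 1%N by rewrite mxrank_ker mxrank_tr (eqP freeP).
have m0 : m != 0.
  apply/eqP => m0; move: mm; rewrite m0 dot_mulmx mul0mx mxE => /eqP.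
  by rewrite eq_sym oner_eq0.
have /sub_rVP[c nE] : (n <= m)%MS.
  apply: submx_trans (kerE _ na nb) _.
  rewrite -(mxrank_leqif_sup (kerE _ ma mb)) rk1.
  by rewrite eqn_leq rank_rV m0.
have cc : c * c = 1.
  move: nn; rewrite nE dot_mulmx linearZ/= -scalemxAl -scalemxAr scalerA mxE.
  by rewrite -dot_mulmx mm mulr1.
by move=> i j; rewrite nE !mxE mulrACA cc mul1r.
Qed.

Lemma unit_coord_le1 n : dot n n = 1 -> forall i, `|n 0 i| <= 1.
Proof.
move=> nn i; rewrite -(@ler_pXn2r _ 2)// ?nnegrE// expr1n -normrX.
rewrite ger0_norm ?sqr_ge0// -nn /dot (bigD1 i)//= -expr2 lerDl.
by apply: sumr_ge0 => j _; rewrite -expr2 sqr_ge0.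
Qed.

Lemma sqr_dot a b : dot a b ^+ 2 =
  \sum_(k : 'I_3 * 'I_3) (a 0 k.1 * a 0 k.2) * (b 0 k.1 * b 0 k.2).
Proof.
rewrite expr2 /dot big_distrlr/= pair_big/=.
by apply: eq_bigr => k _; rewrite mulrACA.
Qed.

End Normals.

Section NormalsOfSurface.
Context (R : realType).
Implicit Types (S : set (torus3 R)).

Lemma smooth_on_differentiable (V W : normedModType R) (U : set V) (f : V -> W) :
  smooth_on U f -> forall x, U x -> differentiable f x.
Proof. by move=> /(_ 1%N)[]. Qed.

(** The differential of a chart is injective, so its partial derivatives are two
    independent tangent vectors. *)
Lemma unit_normal_prod_unique S p (n m : 'rV[R]_3) : regular_surface S -> S p ->
  unit_normal S p n -> unit_normal S p m ->
  forall i j, n 0 i * n 0 j = m 0 i * m 0 j.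
Proof.
move=> rS Sp [nn nT] [mm mT].
have [U [x [xU [u Uu xup]]]] := rS p Sp.
have [_ /smooth_on_differentiable sx dx_inj _ _] := xU.
have dx : differentiable x u by apply: sx; case: Uu.
have tan v : tangent_space S p ('D_v x u) by exists U, x, u, v.
apply: (unit_orthogonal_line _ nn (nT _ (tan (1, 0))) (nT _ (tan (0, 1)))
  mm (mT _ (tan (1, 0))) (mT _ (tan (0, 1)))).
move=> s t; rewrite !deriveE// -!linearZ -linearD => h.
have : (s, t) = 0 :> R * R.
  apply: (dx_inj u Uu); rewrite linear0 -h; congr ('d x u _).
  by congr pair; rewrite /= /GRing.scale/= !mulr1 !mulr0 ?addr0 ?add0r.
by case=> -> ->.
Qed.

(** The field [n] itself may fail to be measurable, but its products of
    coordinates coincide locally with those of a smooth unit normal. *)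
Lemma normal_prod_measurable S (n : torus3 R -> 'rV[R]_3) (i j : 'I_3) :
  compact S -> regular_surface S -> has_local_smooth_normal S ->
  (forall p, S p -> unit_normal S p (n p)) ->
  measurable_fun (S : set (torus3_borel R))
    (fun p : torus3_borel R => n p 0 i * n p 0 j).
Proof.
move=> cS rS lS nS; apply: torus_locally_measurable.
  exact: torus_compact_measurable.
move=> p Sp; have [V [nu [oV Vp snu nuV]]] := lS p Sp.
exists V, (fun q => nu q 0 i * nu q 0 j).
split=> // [B oB|q Sq Vq].
  rewrite torus_openE; set f := (nu \o _) in snu.
  pose h := fun y : 'rV[R]_3 => f y 0 i * f y 0 j.
  change (open (@torus_proj R @^-1` V `&` h @^-1` B)).
  rewrite openE => y [Vy By]; apply: filterI; first exact: open_nbhs_nbhs.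
  suff : {for y, continuous h} by apply; exact: open_nbhs_nbhs.
  have fc l : {for y, continuous (fun z => f z 0 l)}.
    apply: (@continuous_comp _ _ _ f (fun v : 'rV[R]_3 => v 0 l)).
      exact: (snu 0%N).
    exact: coord_continuous.
  exact: continuousM (fc i) (fc j).
by apply: (@unit_normal_prod_unique S q) => //; [exact: nS|exact: nuV].
Qed.

Lemma normal_integralE S
    (sigma : {finite_measure set (torus3_borel R) -> \bar R})
    (n : torus3 R -> 'rV[R]_3) : toral_surface S sigma n ->
  normal_integral S sigma n =
  (\sum_(k : 'I_3 * 'I_3)
     (\int[sigma]_(p in S) (n p 0 k.1 * n p 0 k.2))%R ^+ 2)%:E.
Proof.
move=> [cS rS lS _ nS].
rewrite /normal_integral; under eq_integral do rewrite sqr_dot.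
apply: (integral_kernel_sum sigma
  (f := fun (k : 'I_3 * 'I_3) p => n p 0 k.1 * n p 0 k.2)).
- exact: torus_compact_measurable.
- by move=> k; exact: normal_prod_measurable.
- move=> k p Sp; have [nn _] := nS p Sp; rewrite normrM -[leRHS]mulr1.
  by rewrite ler_pM//; exact: unit_coord_le1.
Qed.

Lemma normal_integral_trace S
    (sigma : {finite_measure set (torus3_borel R) -> \bar R})
    (n : torus3 R -> 'rV[R]_3) (A : R) : toral_surface S sigma n ->
  sigma S = A%:E -> \sum_i \int[sigma]_(p in S) (n p 0 i * n p 0 i) = A.
Proof.
move=> [cS rS lS _ nS] SA.
have mS := torus_compact_measurable cS.
have int i : sigma.-integrable S (EFin \o (fun p => n p 0 i * n p 0 i)).
  apply: measurable_bounded_integrable => //.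
  - by rewrite ltey_eq fin_num_measure.
  - exact: normal_prod_measurable.
  - exists 1; split => // M M1 p Sp /=; apply: le_trans (ltW M1).
    have [nn _] := nS p Sp; rewrite normrM -[leRHS]mulr1.
    by rewrite ler_pM//; exact: unit_coord_le1.
apply: EFin_inj; rewrite -SA -sumEFin.
transitivity (\sum_i \int[sigma]_(p in S) (n p 0 i * n p 0 i)%:E)%E.
  apply: eq_bigr => i _; rewrite /Rintegral fineK//.
  by apply: integrable_fin_num; [exact: mS|exact: int].
rewrite -(integral_sum mS int)/=.
transitivity (\int[sigma]_(p in S) (cst 1%:E p))%E.
  by apply: eq_integral => p /set_mem/nS[n1 _]; rewrite sumEFin /cst -n1.
by rewrite integral_cst// mul1e.
Qed.

(** Lower bound: discard the off-diagonal moments and compare the sum of the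
    squares of the three diagonal ones with the square of their sum [A]. Upper
    bound: the integrand is at most one. *)
Lemma normal_integral_bounds S
    (sigma : {finite_measure set (torus3_borel R) -> \bar R})
    (n : torus3 R -> 'rV[R]_3) (A : R) : toral_surface S sigma n ->
  sigma S = A%:E ->
  exists2 I : R, normal_integral S sigma n = I%:E & A ^+ 2 / 3 <= I <= A ^+ 2.
Proof.
move=> tS SA; have IE := normal_integralE tS; move: (IE).
set I := \sum_k _ => IE'; exists I => //; apply/andP; split.
  pose a i := \int[sigma]_(p in S) (n p 0 i * n p 0 i).
  have tr : \sum_i a i = A := normal_integral_trace tS SA.
  apply: (@le_trans _ _ (\sum_i a i ^+ 2)).
    rewrite -tr !big_ord_recl !big_ord0 !addr0.
    move: (a _) (a _) (a _) => u v w; rewrite ler_pdivrMr//.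
    have := sqr_ge0 (u - v); have := sqr_ge0 (u - w); have := sqr_ge0 (v - w).
    by rewrite !expr2; lra.
  have -> : \sum_i a i ^+ 2 = \sum_i
      (\int[sigma]_(p in S) (n p 0 (i, i).1 * n p 0 (i, i).2))%R ^+ 2 by [].
  rewrite /I -(pair_bigA _ (fun i j =>
    (\int[sigma]_(p in S) (n p 0 i * n p 0 j))%R ^+ 2))/=.
  apply: ler_sum => i _; rewrite [leRHS](bigD1 i)//= lerDl.
  by apply: sumr_ge0 => j _; exact: sqr_ge0.
have [cS rS lS _ nS] := tS.
have mS := torus_compact_measurable cS.
rewrite -lee_fin -IE /normal_integral.
have -> : (A ^+ 2)%:E = (\int[sigma \x sigma]_(z in S `*` S) (cst 1%:E z))%E.
  rewrite integral_cst//; last exact: measurableX.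
  rewrite mul1e; transitivity (sigma S * sigma S)%E; first by rewrite SA -EFinM.
  exact/esym/product_measure1E.
apply: ge0_le_integral => //.
- exact: measurableX.
- by move=> z _; rewrite lee_fin sqr_ge0.
- apply/measurable_EFinP; under eq_fun do rewrite sqr_dot.
  have mn k := normal_prod_measurable k.1 k.2 cS rS lS nS.
  apply: measurable_sum => k; apply: measurable_realfun.measurable_funM.
    apply: (measurable_comp mS _ (mn k)); first by move=> _ [z [Sz _] <-].
    exact: measurable_funTS.
  apply: (measurable_comp mS _ (mn k)); first by move=> _ [z [_ Sz] <-].
  exact: measurable_funTS.
- move=> z [/nS[n1 _] /nS[n2 _]]; rewrite lee_fin.
  (* Cauchy-Schwarz: the component of the first normal orthogonal to the second
     one has nonnegative squared length. *)
  have : 0 <= dot (n z.1 - dot (n z.1) (n z.2) *: n z.2)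
                  (n z.1 - dot (n z.1) (n z.2) *: n z.2).
    by apply: sumr_ge0 => i _; rewrite -expr2 sqr_ge0.
  move: n1 n2; rewrite /dot !big_ord_recl !big_ord0 !addr0 !mxE.
  nra.
Qed.

End NormalsOfSurface.

(** * Lebesgue measure of the plane *)

(** The image of a measure under a measurable map, with the measurability proof
    as an explicit argument, so that it can be used as a bundled measure. *)
Definition image_measure d1 d2 (T1 : measurableType d1) (T2 : measurableType d2)
    (R : realFieldType) (m : {measure set T1 -> \bar R}) (f : T1 -> T2)
    (mf : measurable_fun setT f) : {measure set T2 -> \bar R} :=
  measure_function_pushforward__canonical__measure_function_Measure m mf.

Section PlaneLebesgue.
Context (R : realType).
Local Notation leb := (@lebesgue_measure R).
Local Notation leb2 := (leb \x leb)%E.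

(** An open set of the plane is the countable union of the rational boxes that it
    contains. *)
Lemma open_plane_measurable (O : set (R * R)) : open O ->
  (measurable : set (set (measurableTypeR R * measurableTypeR R))) O.
Proof.
move=> oO.
pose box (q : rat * rat * (rat * rat)) : set (R * R) :=
  `](ratr q.1.1 : R), ratr q.1.2[%classic `*`
  `](ratr q.2.1 : R), ratr q.2.2[%classic.
have -> : O = \bigcup_q (if `[< box q `<=` O >] then box q else set0).
  apply/seteqP; split=> [[s t] Ost|u [q _]]; last first.
    by case: asboolP => // qO; exact: qO.
  have /nbhs_ballP[e /= e0 eO] : nbhs (s, t) O by exact: open_nbhs_nbhs.
  have rat_above (x : R) : exists2 q : rat, x - e < ratr q & ratr q < x.
    have /rat_in_itvoo[q] : x - e < x by rewrite ltrBlDr ltrDl.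
    by rewrite in_itv => /= /andP[? ?]; exists q.
  have rat_below (x : R) : exists2 q : rat, x < ratr q & ratr q < x + e.
    have /rat_in_itvoo[q] : x < x + e by rewrite ltrDl.
    by rewrite in_itv => /= /andP[? ?]; exists q.
  have [a sa as_] := rat_above s; have [b sb bs] := rat_below s.
  have [c tc ct] := rat_above t; have [d td dt] := rat_below t.
  exists ((a, b), (c, d)) => //; case: asboolP.
    by move=> _; rewrite /box; split; rewrite /= in_itv/=; apply/andP.
  case=> -[s' t'] [/=]; rewrite !in_itv/= => /andP[h1 h2] /andP[h3 h4].
  apply: eO; split; rewrite /ball/= ltr_norml; apply/andP; split; lra.
apply: countable_bigcupT_measurable => // q.
by case: asboolP => // _; apply: measurableX; exact: measurable_itv.
Qed.

(** The hypothesis on [e] says that it is a sign: translations and reflections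
    preserve the length of half-open intervals, which determines the measure. *)
Lemma lebesgue_measure_isometry (e c : R) (A : set R) : e ^+ 2 = 1 ->
  measurable A -> leb ((fun t => e * t + c) @^-1` A) = leb A.
Proof.
move=> e1 mA.
have mf : measurable_fun [set: measurableTypeR R]
    (fun t : measurableTypeR R => e * t + c : measurableTypeR R).
  by apply: measurable_funD => //; exact: measurable_funM.
apply/esym; rewrite -[RHS]/(pushforward leb (fun t => e * t + c) A).
apply: (@lebesgue_measure_unique R
  (image_measure leb mf))
  => //= _ [[a b]] _ <-.
rewrite /pushforward.
have /orP[/eqP ->|/eqP ->] : (e == 1) || (e == -1).
  by rewrite -eqf_sqr e1 expr1n.
- rewrite (_ : _ @^-1` _ = `]a - c, b - c]%classic); last first.
    by apply/seteqP; split=> t /=; rewrite !in_itv/= mul1r ltrBlDr lerBrDr.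
  by rewrite !lebesgue_measure_itv/= !lte_fin ltrD2r -!EFinB opprD addrACA subrr addr0.
rewrite (_ : _ @^-1` _ = `[c - b, c - a[%classic); last first.
  by apply/seteqP; split=> t /=; rewrite !in_itv/= => /andP[? ?]; apply/andP; lra.
rewrite !lebesgue_measure_itv/= !lte_fin ltrD2l ltrN2 -!EFinB; case: ifP => // _.
by congr EFin; ring.
Qed.

(** These are the changes of variables between a fundamental band of an annulus
    and its edge charts. The product measure is determined by its values on
    rectangles, which reduces the claim to the line. *)
Lemma plane_lebesgue_isometry (e c d : R)
    (X : set (measurableTypeR R * measurableTypeR R)) :
  e ^+ 2 = 1 -> measurable X ->
  leb2 ((fun u => (u.1 + c, e * u.2 + d)) @^-1` X) = leb2 X.
Proof.
move=> e1 mX.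
pose f (u : measurableTypeR R * measurableTypeR R) :
  measurableTypeR R * measurableTypeR R := (u.1 + c, e * u.2 + d).
have mf : measurable_fun setT f.
  apply/measurable_fun_pairP; split; apply: measurable_funD => //.
  exact: measurable_funM.
apply/esym; rewrite -[RHS]/(pushforward leb2 f X).
apply: (@product_measure_unique _ _ _ _ R leb leb
  (image_measure leb2 mf))
  => // A B mA mB.
transitivity (leb2 (((fun t : R => 1 * t + c) @^-1` A) `*`
                    ((fun t : R => e * t + d) @^-1` B))).
  by congr (leb2 _); apply/seteqP; split=> u /=; rewrite mul1r.
rewrite [LHS]product_measure1E//.
- by congr (_ * _)%E; apply: lebesgue_measure_isometry; rewrite ?expr1n.
- rewrite -[X in measurable X]setTI; apply: measurable_funD => //; exact: measurable_funM.
- rewrite -[X in measurable X]setTI; apply: measurable_funD => //; exact: measurable_funM.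
Qed.

End PlaneLebesgue.

(** * Affine maps and flat annuli in the torus *)

Section Affine.
Context (R : realType).
Implicit Types (c v w : 'rV[R]_3).

Definition plane_lin v w (h : R * R) : 'rV[R]_3 := h.1 *: v + h.2 *: w.

Fact plane_lin_is_linear v w : linear (plane_lin v w).
Proof.
move=> a h k; rewrite /plane_lin /= scalerDr !scalerDl !scalerA.
by rewrite addrACA.
Qed.

HB.instance Definition _ v w := GRing.isLinear.Build R (R * R)%type 'rV[R]_3 _
  (plane_lin v w) (plane_lin_is_linear v w).

Lemma plane_lin_continuous v w : continuous (plane_lin v w).
Proof.
move=> h; apply: cvgD; apply: cvgZr_tmp.
  exact: cvg_fst.
exact: cvg_snd.
Qed.

Definition affine_map c v w (u : R * R) : 'rV[R]_3 := c + plane_lin v w u.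

Lemma affine_map_continuous c v w : continuous (affine_map c v w).
Proof. by move=> h; apply: cvgD; [exact: cvg_cst|exact: plane_lin_continuous]. Qed.

Lemma affine_map_differentiable c v w u : differentiable (affine_map c v w) u.
Proof.
apply: differentiableD; first exact: differentiable_cst.
exact/linear_differentiable/plane_lin_continuous.
Qed.

Lemma diff_affine_map c v w u : 'd (affine_map c v w) u = plane_lin v w :> (_ -> _).
Proof.
rewrite diffD; [|exact: differentiable_cst|
  exact/linear_differentiable/plane_lin_continuous].
have dlin : 'd (plane_lin v w) u = plane_lin v w :> (_ -> _).
  by apply: (@diff_lin _ _ _ (plane_lin v w)); exact: plane_lin_continuous.
have dcst := @diff_cst R (R * R)%type 'rV[R]_3 c u.
apply/funext => h; rewrite -[RHS]add0r; congr (_ + _).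
  exact: (congr1 (@^~ h) dcst).
exact: (congr1 (@^~ h) dlin).
Qed.

Lemma derive_affine_map c v w u h :
  'D_h (affine_map c v w) u = plane_lin v w h.
Proof. by rewrite deriveE ?diff_affine_map//; exact: affine_map_differentiable. Qed.

(** Constants are stable under directional derivatives, which makes the induction
    on the order of differentiability go through. *)
Lemma smooth_on_cst (V W : normedModType R) (U : set V) (a : W) :
  smooth_on U (cst a).
Proof.
move=> k; elim: k a => [|k IH] a; first by move=> x _; exact: cst_continuous.
split=> [x _|v]; first exact: differentiable_cst.
rewrite (_ : (fun x => _) = cst 0); first exact: IH.
by apply/funext => x; exact: derive_cst.
Qed.

Lemma smooth_on_affine_map c v w (U : set (R * R)) :
  smooth_on U (affine_map c v w).
Proof.
case=> [x _|k]; first exact: affine_map_continuous.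
split=> [u _|h]; first exact: affine_map_differentiable.
rewrite (_ : (fun x => _) = cst (plane_lin v w h)); first exact: smooth_on_cst.
by apply/funext => u; exact: derive_affine_map.
Qed.

End Affine.

Lemma int_abs_lt1 (R : archiRealDomainType) (x : R) :
  x \is a Num.int -> `|x| < 1 -> x = 0.
Proof. by move=> xint; apply: contraTeq => /(norm_intr_ge1 xint); rewrite leNgt. Qed.

(** Arithmetic in ['I_3] is modulo 3: the three coordinates are written [k],
    [k + 1] and [k + 1 + 1] for whichever [k] is the circle direction. *)
Lemma ord3_cycle (k i : 'I_3) : [|| i == k, i == k + 1 | i == k + 1 + 1].
Proof. by case: k i => [[|[|[|//]]] ?] [[|[|[|//]]] ?]. Qed.

Lemma ord3_add1 (k : 'I_3) : (k + 1 == k) = false.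
Proof. by case: k => [[|[|[|//]]] ?]. Qed.

Lemma ord3_add2 (k : 'I_3) : (k + 1 + 1 == k) = false.
Proof. by case: k => [[|[|[|//]]] ?]. Qed.

Lemma ord3_add3 (k : 'I_3) : k + 1 + 1 + 1 = k.
Proof. by apply/val_inj; case: k => [[|[|[|//]]] ?]. Qed.

Section Annuli.
Context (R : realType).
Implicit Types (k l : 'I_3) (u : R * R) (p : torus3 R) (J : {pred 'I_3}).

Definition axis k : 'rV[R]_3 := delta_mx 0 k.

Definition coord_plane k u : 'rV[R]_3 := affine_map 0 (axis k) (axis (k + 1)) u.

Lemma coord_plane0 k u : coord_plane k u 0 k = u.1.
Proof.
by rewrite !mxE !eqxx eq_sym ord3_add1 /= mulr1 mulr0 addr0 add0r.
Qed.

Lemma coord_plane1 k u : coord_plane k u 0 (k + 1) = u.2.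
Proof. by rewrite !mxE !eqxx ord3_add1 /= mulr1 mulr0 !add0r. Qed.

Lemma coord_plane2 k u : coord_plane k u 0 (k + 1 + 1) = 0.
Proof. by rewrite !mxE ord3_add1 ord3_add2 /= !mulr0 !addr0. Qed.

Lemma torus_proj_coord_planeP k u (y : 'rV[R]_3) :
  torus_proj (coord_plane k u) = torus_proj y <->
  [/\ u.1 - y 0 k \is a Num.int, u.2 - y 0 (k + 1) \is a Num.int &
      y 0 (k + 1 + 1) \is a Num.int].
Proof.
rewrite torus_projP; split=> [h|[h0 h1 h2] i].
  split; first by rewrite -(coord_plane0 k).
    by rewrite -(coord_plane1 k).
  by rewrite -rpredN -[- _]add0r -(coord_plane2 k u).
have /or3P[/eqP ->|/eqP ->|/eqP ->] := ord3_cycle k i.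
- by rewrite coord_plane0.
- by rewrite coord_plane1.
- by rewrite coord_plane2 sub0r rpredN.
Qed.

Definition annulus k : set (torus3 R) :=
  (fun u => torus_proj (coord_plane k u)) @` [set u : R * R | 1/4 <= u.2 <= 3/4].

Definition annuli J : set (torus3 R) := \bigcup_(k in [set` J]) annulus k.

(** By cyclic symmetry consider annuli [k] and [k + 1]. Coordinate [k + 1 + 1]
    vanishes modulo 1 on the first and lies in [[1/4, 3/4]] on the second. *)
Lemma annulus_disjoint k l p : annulus k p -> annulus l p -> k = l.
Proof.
wlog: k l / (l == k) || (l == k + 1) => [wl kp lp|].
  have /or3P[lk|lk|/eqP lk] := ord3_cycle k l.
  - by apply: wl => //; rewrite lk.
  - by apply: wl => //; rewrite lk orbT.
  - by apply/esym/wl => //; rewrite lk ord3_add3 eqxx orbT.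
case/orP => /eqP -> // [u /= uI <-] [v /= vI] /torus_proj_coord_planeP[_ + _].
rewrite coord_plane2 subr0 => /int_abs_lt1 v0; exfalso.
have : v.2 = 0 by apply: v0; rewrite ltr_norml; lra.
by move=> v2; move: vI; rewrite v2; lra.
Qed.

Lemma coord_plane_continuous k :
  continuous (fun u => torus_proj (coord_plane k u) : torus3 R).
Proof.
move=> u; apply: (@continuous_comp _ _ _ (coord_plane k) (@torus_proj R)).
  exact: affine_map_continuous.
exact: torus_proj_continuous.
Qed.

(** The circle coordinate may be restricted to [[0, 1]] by subtracting its integer
    part. *)
Lemma annulus_compact k : compact (annulus k).
Proof.
rewrite (_ : annulus k = (fun u => torus_proj (coord_plane k u)) @`
  (`[0, 1]%classic `*` `[1/4, 3/4]%classic)); last first.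
  apply/seteqP; split=> [_ [u /= uI <-]|_ [u [_ uI] <-]]; last first.
    by exists u => //; move: uI; rewrite /= in_itv.
  exists (u.1 - (Num.floor u.1)%:~R, u.2).
    split; rewrite /= in_itv//=.
    rewrite subr_ge0 floor_le_tmp/= lerBlDr addrC ltW//.
    by have := floorD1_gt u.1; rewrite intrD1.
  apply/torus_proj_coord_planeP; rewrite coord_plane0 coord_plane1 coord_plane2/= subrr.
  by rewrite addrAC subrr add0r rpredN intr_int rpred0.
apply: continuous_compact.
  by apply: continuous_subspaceT; exact: coord_plane_continuous.
by apply: compact_setX; exact: segment_compact.
Qed.

Lemma annuli_compact J : compact (annuli J).
Proof.
rewrite /annuli bigcup_pred.
by apply: bigsetU_compact => k _; exact: annulus_compact.
Qed.

End Annuli.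

(** * Affine charts of the annuli *)

Section AnnulusCharts.
Context (R : realType).
Implicit Types (k l : 'I_3) (u : R * R) (p : torus3 R) (J : {pred 'I_3}).

(** An open set which contains annulus [k] and misses the other two, so that a
    union of annuli containing annulus [k] coincides with it there. *)
Definition isolating k : set (torus3 R) := ~` annuli [pred l | l != k].

Lemma isolating_open k : open (isolating k).
Proof.
by apply: closed_openC; apply: torus_compact_closed; exact: annuli_compact.
Qed.

Lemma annulus_isolating k : annulus k `<=` isolating k.
Proof.
by move=> p kp [l /= /negP lk lp]; apply: lk; rewrite (annulus_disjoint lp kp).
Qed.

Lemma annuli_isolating J k : annuli J `&` isolating k `<=` annulus k.
Proof.
move=> p [[l Jl lp] av]; have [<-//|lk] := eqVneq l k.
by case: av; exists l.
Qed.

(** For [eps = 1] the height increases from the lower edge [1/4] as [t] increases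
    from 0; for [eps = -1] it decreases from the upper edge [3/4]. *)
Definition edge_height (eps t : R) : R := 1/2 + eps * (t - 1/4).

(** A neighbourhood of one edge of annulus [k], that edge being the image of the
    boundary line of the half-plane. *)
Definition edge_chart eps k u : 'rV[R]_3 :=
  affine_map ((1/2 - eps/4) *: axis R (k + 1))
    (axis R k) (eps *: axis R (k + 1)) u.

Lemma edge_chartE eps k u :
  edge_chart eps k u = coord_plane k (u.1, edge_height eps u.2).
Proof.
rewrite /edge_chart /coord_plane /affine_map /plane_lin add0r /= addrCA; congr (_ + _).
by rewrite scalerA -scalerDl; congr (_ *: _); rewrite /edge_height; lra.
Qed.

Lemma sign_cases (eps : R) : eps ^+ 2 = 1 -> eps = 1 \/ eps = -1.
Proof.
by move/eqP; rewrite -[X in _ == X](expr1n _ 2) eqf_sqr => /orP[/eqP|/eqP]; auto.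
Qed.

Lemma edge_heightK eps : eps ^+ 2 = 1 ->
  cancel (edge_height eps) (fun t => 1/4 + eps * (t - 1/2)).
Proof. by move=> /sign_cases[->|->] t; rewrite /edge_height; lra. Qed.

Lemma edge_heightVK eps : eps ^+ 2 = 1 ->
  cancel (fun t => 1/4 + eps * (t - 1/2)) (edge_height eps).
Proof. by move=> /sign_cases[->|->] t; rewrite /edge_height; lra. Qed.

Lemma edge_height_range eps t : eps ^+ 2 = 1 ->
  (1/4 <= edge_height eps t <= 3/4) = (0 <= t <= 1/2).
Proof.
by move=> /sign_cases[->|->]; rewrite /edge_height;
  apply/idP/idP => /andP[? ?]; apply/andP; split; lra.
Qed.

(** The open interval of length 1 makes the circle coordinate injective modulo 1,
    and the height stops short of the other edge, beyond which the image would
    leave the annulus. *)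
Definition edge_domain (a : R) : set (R * R) :=
  [set u | a < u.1 < a + 1 /\ u.2 < 1/2].

Lemma edge_domain_open a : open (edge_domain a).
Proof.
rewrite (_ : edge_domain a =
    fst @^-1` `]a, a + 1[%classic `&` snd @^-1` `]-oo, (1/2)%R[%classic).
  by apply: openI; apply: open_comp; [move=> u _; exact: cvg_fst|
    exact: interval_open|move=> u _; exact: cvg_snd|exact: interval_open].
by apply/seteqP; split=> u; rewrite /edge_domain /= !in_itv.
Qed.

(** Heights in [[1/4, 3/4]] that agree modulo 1 are equal. *)
Lemma edge_chart_inj eps k a u v : eps ^+ 2 = 1 ->
  (edge_domain a `&` @half_plane R) u -> 1/4 <= v.2 <= 3/4 ->
  torus_proj (coord_plane k v) = torus_proj (edge_chart eps k u) ->
  v.2 = edge_height eps u.2.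
Proof.
move=> e1 [[/= _ u12] u20] vI; rewrite edge_chartE => /torus_proj_coord_planeP[_ + _].
rewrite coord_plane1 => /int_abs_lt1 h; apply/eqP; rewrite -subr_eq0 h//=.
have /andP[] : 1/4 <= edge_height eps u.2 <= 3/4.
  by rewrite edge_height_range//; apply/andP; split=> //; exact: ltW.
by rewrite /= ltr_norml => ? ?; case/andP: vI => ? ?; apply/andP; split; lra.
Qed.

(** The delicate clause is openness onto the image. The inverse of the chart,
    extended to an affine map [back] from the three-space to the plane, pulls an
    open set back to an open set; cutting it down to heights in [(0, 1)] and
    normal coordinates in [(-1, 1)] removes the integer ambiguity of lifts, and
    intersecting with the isolating set removes the other annuli. *)
Lemma edge_chart_local_param J k eps a : k \in J -> eps ^+ 2 = 1 ->
  local_param (annuli J) (edge_domain a) (edge_chart eps k).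
Proof.
move=> Jk e1; have eps0 : eps != 0.
  by apply/eqP => e0; move: e1; rewrite e0 expr0n/= => /eqP; rewrite eq_sym oner_eq0.
have dom_height u : (edge_domain a `&` @half_plane R) u ->
    1/4 <= edge_height eps u.2 <= 3/4.
  by case=> -[_ u12] u20; rewrite edge_height_range//; apply/andP; split=> //; exact: ltW.
split.
- exact: edge_domain_open.
- exact: smooth_on_affine_map.
- move=> u _ h h'; rewrite diff_affine_map => hh'.
  have co i : plane_lin (axis R k) (eps *: axis R (k + 1)) h 0 i =
    plane_lin (axis R k) (eps *: axis R (k + 1)) h' 0 i by rewrite hh'.
  have := co k; have := co (k + 1); rewrite !mxE !eqxx ord3_add1.
  rewrite [k == _]eq_sym ord3_add1 /= !(mulr0, mulr1, addr0, add0r).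
  by case: h h' {hh' co} => [? ?] [? ?] /= /(mulIf eps0) -> ->.
- move=> u v /set_mem uD /set_mem vD /=; rewrite [in LHS]edge_chartE => uv.
  have := @edge_chart_inj eps k a v (u.1, edge_height eps u.2) e1 vD
    (dom_height u uD) uv.
  move=> /= /(can_inj (edge_heightK e1)) uv2.
  move: uv => /torus_proj_coord_planeP[/= + _ _].
  rewrite edge_chartE coord_plane0/= => /int_abs_lt1 uv1.
  case: uD vD => -[/= u1 _] _ [[/= v1 _] _].
  have {}uv1 : u.1 = v.1.
    apply/eqP; rewrite -subr_eq0 uv1// ltr_norml.
    by case/andP: u1 v1 => ? ? /andP[? ?]; apply/andP; split; lra.
  by case: u v uv1 uv2 {u1 v1} => ? ? [? ?] /= -> ->.
move=> W oW.
pose back (y : 'rV[R]_3) : R * R := (y 0 k, 1/4 + eps * (y 0 (k + 1) - 1/2)).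
pose O : set 'rV[R]_3 := [set y | [/\ (edge_domain a `&` W) (back y),
  y 0 (k + 1) \in `]0, 1[ & y 0 (k + 1 + 1) \in `]-1, 1[ ]].
exists ((@torus_proj R @` O) `&` isolating k).
  apply: openI; last exact: isolating_open.
  apply: torus_proj_open.
  have -> : O = back @^-1` (edge_domain a `&` W) `&`
    ((fun y => y 0 (k + 1)) @^-1` `]0, 1[%classic `&`
    (fun y => y 0 (k + 1 + 1)) @^-1` `]-1, 1[%classic).
    by apply/seteqP; split=> y; [case=> ? ? ?|case=> ? [? ?]].
  apply: openI; last apply: openI.
  - apply: open_comp; last by apply: openI => //; exact: edge_domain_open.
    have cback : continuous back.
      move=> y; apply: (@cvg_pair _ _ _ (nbhs y) (nbhs (back y).1)
        (nbhs (back y).2) _ _ _ (fun y => (back y).1) (fun y => (back y).2)).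
        exact: coord_continuous.
      apply: cvgD; first exact: cvg_cst.
      apply: cvgM; first exact: cvg_cst.
      by apply: cvgB; [exact: coord_continuous|exact: cvg_cst].
    by move=> y _; exact: cback.
  - apply: open_comp; last exact: interval_open.
    by move=> y _; exact: coord_continuous.
  - apply: open_comp; last exact: interval_open.
    by move=> y _; exact: coord_continuous.
apply/seteqP; split=> [_ [u [uD Wu] <-]|p [Jp [[y Oy yp] av]]].
  have kp : annulus k (torus_proj (edge_chart eps k u)).
    by exists (u.1, edge_height eps u.2) => /=; [exact: dom_height|rewrite edge_chartE].
  split; first by exists k.
  split; last exact: annulus_isolating.
  exists (edge_chart eps k u) => //; rewrite edge_chartE; split.
  - rewrite /back coord_plane0 coord_plane1/= edge_heightK//.
    by rewrite -surjective_pairing; split=> //; case: uD.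
  - rewrite coord_plane1/= in_itv/=; have /andP[? ?] := dom_height u uD.
    by apply/andP; split; lra.
  - by rewrite coord_plane2 in_itv/=; apply/andP; split; lra.
have [v /= vI vp] := annuli_isolating (conj Jp av).
move: Oy => [yD]; rewrite !in_itv/= => /andP[y10 y11] /andP[y20 y21].
move: (vp); rewrite -yp => /torus_proj_coord_planeP[_ vy1 y2].
have {}vy1 : v.2 = y 0 (k + 1).
  apply/eqP; rewrite -subr_eq0 (int_abs_lt1 vy1)// ltr_norml.
  by case/andP: vI => ? ?; apply/andP; split; lra.
exists (back y).
  split; last by case: yD.
  split; first by case: yD.
  have := edge_height_range (back y).2 e1; rewrite {1 2}/back/= edge_heightVK//.
  by rewrite -vy1 vI => /esym/andP[+ _]; rewrite vy1.
rewrite /= edge_chartE; apply/torus_proj_coord_planeP; rewrite /= edge_heightVK//.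
by rewrite !subrr rpred0.
Qed.

(** The chart starts at the lower edge unless the point lies on the upper one, and
    [a] is 0 unless the circle coordinate is an integer, in which case it is 1/2. Keeping [a] in
    [[0, 1)] means that the chart meets only two unit intervals. *)
Lemma edge_chart_cover k p : annulus k p -> exists eps a u,
  [/\ eps ^+ 2 = 1, 0 <= a < 1, (edge_domain a `&` @half_plane R) u &
      torus_proj (edge_chart eps k u) = p].
Proof.
move=> [v /= vI <-].
have [eps [e1 eI]] : exists eps : R, eps ^+ 2 = 1 /\ 1/4 + eps * (v.2 - 1/2) < 1/2.
  have [v2|v2] := ltP v.2 (3/4); first by exists 1; rewrite expr1n; split=> //; lra.
  by exists (-1); rewrite sqrrN expr1n; split=> //; lra.
pose s := v.1 - (Num.floor v.1)%:~R.
have s0 : 0 <= s by rewrite subr_ge0 floor_le_tmp.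
have s1 : s < 1 by have := floorD1_gt v.1; rewrite intrD1 /s; lra.
have [a [s' [aI s'a s's]]] : exists a s' : R,
    [/\ 0 <= a < 1, a < s' < a + 1 & s' - s \is a Num.int].
  have [sp|sn] := ltP 0 s.
    by exists 0, s; rewrite subrr rpred0; split=> //; apply/andP; split=> //; lra.
  exists (1/2), 1; have -> : s = 0 by apply/le_anti/andP.
  by rewrite subr0 rpred1; split=> //; apply/andP; split; lra.
exists eps, a, (s', 1/4 + eps * (v.2 - 1/2)); split=> //.
  split=> //=; rewrite /half_plane/=.
  have := edge_height_range (1/4 + eps * (v.2 - 1/2)) e1.
  by rewrite edge_heightVK// vI => /esym/andP[].
rewrite edge_chartE /= edge_heightVK//; apply/torus_proj_coord_planeP.
rewrite coord_plane0 coord_plane1 coord_plane2/= subrr !rpred0; split=> //.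
by rewrite -[v.1](subrK (Num.floor v.1)%:~R) -/s opprD addrA rpredB// intr_int.
Qed.

End AnnulusCharts.

(** * Tangent vectors, normals and area density of the annuli *)

Section AnnuliSurface.
Context (R : realType).
Implicit Types (k l : 'I_3) (u : R * R) (p : torus3 R) (J : {pred 'I_3}).

Lemma dot_axis k (v : 'rV[R]_3) : dot (axis R k) v = v 0 k.
Proof.
rewrite /dot (bigD1 k)//= big1 ?addr0 => [|i /negPf ik].
  by rewrite mxE !eqxx mul1r.
by rewrite mxE eqxx ik mul0r.
Qed.

Lemma annulus_lift_int k (y : 'rV[R]_3) :
  annulus k (torus_proj y) -> y 0 (k + 1 + 1) \is a Num.int.
Proof. by move=> [v _ /torus_proj_coord_planeP[]]. Qed.

(** Along any chart of the union, near the point, the coordinate normal to annulus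
    [k] is an integer on the half-plane, hence constant by continuity. Its
    derivative vanishes in the directions pointing into the half-plane, through
    a one-sided limit since the point may lie on the boundary line, and in the
    opposite directions by linearity. *)
Lemma tangent_annuli J k p w : annulus k p ->
  tangent_space (annuli J) p w -> w 0 (k + 1 + 1) = 0.
Proof.
move=> kp [U [x [u [v [xU Uu xup ->]]]]]; set m := k + 1 + 1.
have [oU sx _ _ /(_ setT openT)[V _ imV]] := xU.
have dx : differentiable x u.
  by apply: smooth_on_differentiable sx _ _; case: Uu.
have cx : {for u, continuous x} by exact: differentiable_continuous.
have cxm : {for u, continuous (fun z => x z 0 m)}.
  apply: (@continuous_comp _ _ _ x (fun y : 'rV[R]_3 => y 0 m)) => //.
  exact: coord_continuous.
have flat : \forall z \near u, half_plane z -> x z 0 m = x u 0 m.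
  have nU : \forall z \near u, U z by apply: open_nbhs_nbhs; case: Uu.
  have nA : \forall z \near u, isolating k (torus_proj (x z)).
    have : {for u, continuous (@torus_proj R \o x)}.
      by apply: continuous_comp => //; exact: torus_proj_continuous.
    apply; apply: open_nbhs_nbhs; split; first exact: isolating_open.
    by rewrite /= xup; exact: annulus_isolating.
  have n1 : \forall z \near u, `|x u 0 m - x z 0 m| < 1.
    by move/cvgrPdist_lt : cxm; apply.
  near=> z => Hz; apply/eqP; rewrite eq_sym -subr_eq0; apply/eqP/int_abs_lt1.
    apply: rpredB; apply: annulus_lift_int; first by rewrite xup.
    apply: (@annuli_isolating _ J); split; last by near: z.
    have : (annuli J `&` V) ((@torus_proj R \o x) z).
      by rewrite -imV; exists z => //; split=> //; split=> //; near: z.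
    by case.
  by near: z.
have pos v' : 0 <= v'.2 -> ('D_v' x u) 0 m = 0.
  move=> v0.
  pose q (h : R) := (h^-1 *: (x (h *: v' + u) - x u)).
  have cq : q @ 0^' --> 'D_v' x u by exact: diff_derivable.
  have cqm : (fun h => q h 0 m) @ 0^'+ --> ('D_v' x u) 0 m.
    apply: (@cvg_comp _ _ _ q (fun y : 'rV[R]_3 => y 0 m)); last first.
      exact: coord_continuous.
    apply: cvg_trans cq; apply: cvg_app; apply: within_subset => h /=.
    by rewrite lt_neqAle eq_sym => /andP[].
  have cq0 : (fun h => q h 0 m) @ 0^'+ --> (0 : R).
    apply: cvg_near_cst.
    have cs : (fun h : R => h *: v' + u) @ 0^'+ --> u.
      apply: cvg_at_right_filter.
      rewrite -[X in _ --> X]add0r -(scale0r v').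
      by apply: cvgD; [apply: cvgZr_tmp; exact: cvg_id|exact: cvg_cst].
    have nflat := cs _ flat.
    near=> h; rewrite !mxE.
    have -> : x (h *: v' + u) 0 m = x u 0 m.
      have : half_plane (h *: v' + u) -> x (h *: v' + u) 0 m = x u 0 m.
        by near: h; exact: nflat.
      apply; rewrite /half_plane/= addr_ge0//; last by case: Uu.
      by rewrite mulr_ge0//; near: h; exact: nbhs_right_ge.
    by rewrite subrr mulr0.
  exact: cvg_unique cqm cq0.
have [/pos//|v0] := leP 0 v.2.
have : ('D_(- v) x u) 0 m = 0 by apply: pos; rewrite /= oppr_ge0 ltW.
by rewrite !deriveE// linearN mxE => /eqP; rewrite oppr_eq0 => /eqP.
Unshelve. all: by end_near. Qed.

Lemma annuli_unit_normal J k p : annulus k p ->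
  unit_normal (annuli J) p (axis R (k + 1 + 1)).
Proof.
move=> kp; split=> [|w wT]; rewrite dot_axis; first by rewrite mxE !eqxx.
exact: tangent_annuli wT.
Qed.

Lemma annuli_regular J : regular_surface (annuli (R := R) J).
Proof.
move=> p [k Jk kp]; have [eps [a [u [e1 _ uD up]]]] := edge_chart_cover kp.
exists (edge_domain a), (edge_chart eps k).
by split; [exact: edge_chart_local_param|exists u].
Qed.

Lemma annuli_smooth_normal J : has_local_smooth_normal (annuli (R := R) J).
Proof.
move=> p [k Jk kp]; exists (isolating k), (cst (axis R (k + 1 + 1))); split.
- exact: isolating_open.
- exact: annulus_isolating.
- exact: smooth_on_cst.
- by move=> q /annuli_isolating; exact: annuli_unit_normal.
Qed.

(** The axis normal to annulus [k] is [k + 1 + 1], so axis [i] is normal to annulus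
    [i + 1]: its coordinate [i] is the indicator of that annulus. *)
Definition annuli_normal p : 'rV[R]_3 := \row_i (p \in annulus (i + 1))%:R.

Lemma annuli_normalE k p : annulus k p -> annuli_normal p = axis R (k + 1 + 1).
Proof.
move=> kp; apply/rowP => i; rewrite !mxE eqxx /=; congr (_%:R); congr nat_of_bool.
apply/idP/eqP => [/set_mem ip|->]; last by rewrite ord3_add3; exact/mem_set.
by rewrite (annulus_disjoint kp ip) ord3_add3.
Qed.

Lemma area_density_edge_chart eps k u : eps ^+ 2 = 1 ->
  area_density (edge_chart eps k) u = 1.
Proof.
move=> e1; rewrite /area_density !derive_affine_map /plane_lin /=.
rewrite !scale1r !scale0r addr0 add0r.
have -> (v w : 'rV[R]_3) : dot v (eps *: w) = eps * dot v w.
  by rewrite !dot_mulmx linearZ/= -scalemxAr mxE.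
have dotC (v w : 'rV[R]_3) : dot v w = dot w v.
  by apply: eq_bigr => i _; rewrite mulrC.
rewrite ![dot (_ *: _) _]dotC.
have -> (v w : 'rV[R]_3) : dot v (eps *: w) = eps * dot v w.
  by rewrite !dot_mulmx linearZ/= -scalemxAr mxE.
rewrite !dot_axis !mxE !eqxx /= eq_sym ord3_add1 /= mulr0 expr0n subr0.
by rewrite mulr1 mul1r -expr2 e1 sqrtr1.
Qed.

End AnnuliSurface.

(** * Area of the annuli *)

Section AnnuliArea.
Context (R : realType).
Implicit Types (k l : 'I_3) (p : torus3 R) (J : {pred 'I_3}).
Local Notation plane := (measurableTypeR R * measurableTypeR R)%type.
Local Notation leb := (@lebesgue_measure R).
Local Notation leb2 := (leb \x leb)%E.

Definition coord_plane_map k (u : plane) : torus3_borel R :=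
  torus_proj (coord_plane k u).

Lemma continuous_torus_measurable (f : plane -> torus3_borel R) :
  continuous (f : R * R -> torus3 R) -> measurable_fun setT f.
Proof.
move=> cf.
have borelE : (measurable : set (set (torus3_borel R))) = <<s @open (torus3 R) >>.
  by [].
apply: (measurability _ borelE) => _ [V oV <-].
rewrite setTI; apply: open_plane_measurable.
by apply: open_comp => // u _; exact: cf.
Qed.

Lemma coord_plane_map_measurable k : measurable_fun setT (coord_plane_map k).
Proof. by apply: continuous_torus_measurable; exact: coord_plane_continuous. Qed.

(** A fundamental domain for the parametrization of an annulus. *)
Definition unit_band : set plane := `[0, 1[%classic `*` `[1/4, 3/4]%classic.

Lemma unit_band_measurable : measurable unit_band.
Proof. by apply: measurableX; exact: measurable_itv. Qed.

Definition annulus_area k : {measure set (torus3_borel R) -> \bar R} :=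
  image_measure (mrestr leb2 unit_band_measurable) (coord_plane_map_measurable k).

Lemma annulus_areaE k (B : set (torus3_borel R)) :
  annulus_area k B = leb2 (coord_plane_map k @^-1` B `&` unit_band).
Proof. by []. Qed.

Definition annuli_area J : set (torus3_borel R) -> \bar R :=
  msum (fun i => if inord i \in J then annulus_area (inord i) else mzero) 3.

HB.instance Definition _ J := Measure.on (annuli_area J).

Lemma annuli_areaE J B : annuli_area J B = (\sum_(k in J) annulus_area k B)%E.
Proof.
rewrite /annuli_area /msum [RHS]big_mkcond; apply: eq_bigr => k _.
by rewrite inord_val; case: ifP.
Qed.

Lemma unit_band_area : leb2 unit_band = (1/2)%:E.
Proof.
have -> : leb2 unit_band =
    (leb `[0%R, 1%R[%classic * leb `[(1/4)%R, (3/4)%R]%classic)%E.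
  exact: product_measure1E.
rewrite !lebesgue_measure_itv/= !lte_fin ltr01 ifT; last by lra.
by rewrite -!EFinB -EFinM; congr EFin; lra.
Qed.

Lemma annuli_area_fin J : fin_num_fun (annuli_area J).
Proof.
move=> B mB; rewrite annuli_areaE; apply/sum_fin_numP => k _ _.
rewrite annulus_areaE ge0_fin_numE//; apply: (@le_lt_trans _ _ (leb2 unit_band)).
  apply: le_measure; rewrite ?inE; [|exact: unit_band_measurable|by move=> ? []].
  apply: measurableI; last exact: unit_band_measurable.
  by rewrite -[X in measurable X]setTI; exact: coord_plane_map_measurable.
by rewrite unit_band_area ltry.
Qed.

HB.instance Definition _ J :=
  @Measure_isFinite.Build _ _ R (annuli_area J) (annuli_area_fin J).

Lemma annulus_area_disjoint k (B : set (torus3_borel R)) :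
  (forall p, B p -> ~ annulus k p) -> annulus_area k B = 0%E.
Proof.
move=> Bk; rewrite annulus_areaE (_ : _ `&` _ = set0); first by rewrite measure0.
rewrite -subset0 => u [Bu [_ uI]]; by apply: (Bk _ Bu); exists u.
Qed.

Lemma annuli_area_annulus J k (B : set (torus3_borel R)) :
  k \in J -> B `<=` annulus k -> annuli_area J B = annulus_area k B.
Proof.
move=> kJ Bk; rewrite annuli_areaE (bigD1 k)//= big1 ?adde0// => l /andP[_ lk].
apply: annulus_area_disjoint => p /Bk kp lp.
by move: lk; rewrite (annulus_disjoint lp kp) eqxx.
Qed.

Lemma annulus_area_full k (B : set (torus3_borel R)) :
  annulus k `<=` B -> annulus_area k B = (1/2)%:E.
Proof.
move=> kB; rewrite annulus_areaE (_ : _ `&` _ = unit_band) ?unit_band_area//.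
apply/seteqP; split=> [u []//|u uI]; split=> //; apply: kB; exists u => //.
by case: uI; rewrite /= !in_itv.
Qed.

(** Reflection and translation in the height turn the chart domain into the band
    with circle coordinate in [(a, a + 1)], and translating by 1 the part of it
    with coordinate at least 1 recovers the fundamental band. No null sets
    have to be discarded: the upper end of the heights and the circle coordinate
    [a] are not reached by the chart, so they do not occur in [B]. *)
Lemma annulus_area_chart k (eps a : R) (B : set (torus3_borel R)) :
  eps ^+ 2 = 1 -> 0 <= a < 1 -> measurable B ->
  B `<=` (@torus_proj R \o edge_chart eps k) @`
           (edge_domain a `&` @half_plane R) ->
  annulus_area k B =
  leb2 (edge_domain a `&` @half_plane R `&`
        (@torus_proj R \o edge_chart eps k) @^-1` B).
Proof.
move=> e1 /andP[a0 a1] mB Bim.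
have mpre : measurable (coord_plane_map k @^-1` B).
  by rewrite -[X in measurable X]setTI; exact: coord_plane_map_measurable.
pose Y : set plane := coord_plane_map k @^-1` B `&`
  (`]a, a + 1[%classic `*` `[1/4, 3/4]%classic).
have mY : measurable Y.
  by apply: measurableI => //; apply: measurableX; exact: measurable_itv.
have inB v : B (torus_proj (coord_plane k v)) -> 1/4 <= v.2 <= 3/4 ->
    exists u, [/\ (edge_domain a `&` @half_plane R) u,
      v.2 = edge_height eps u.2 & v.1 - u.1 \is a Num.int].
  move=> /Bim[u uD uv] vI; exists u; split=> //.
    exact: (edge_chart_inj e1 uD vI (esym uv)).
  move: uv; rewrite /= edge_chartE => /esym/torus_proj_coord_planeP[+ _ _].
  by rewrite coord_plane0.
(* Change of the height variable: the chart domain becomes [Y]. *)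
transitivity (leb2 Y); last first.
  rewrite -(plane_lebesgue_isometry 0 (1/2 - eps/4) e1 mY); congr (leb2 _).
  have hE t : eps * t + (1/2 - eps/4) = edge_height eps t.
    by rewrite /edge_height; lra.
  apply/seteqP; split=> u /=; rewrite /Y/= hE addr0 !in_itv/=.
    case=> Bu [u1 u2]; have [v [vD vu _]] := inB _ Bu u2.
    have uv : u.2 = v.2 by apply: (can_inj (edge_heightK e1)).
    split; last by rewrite edge_chartE.
    case: vD => -[_ v2] v0; split; first by split=> //=; rewrite uv.
    by rewrite /half_plane/= uv.
  rewrite edge_chartE => -[[[u1 u2] u0] Bu]; split=> //; split=> //.
  by rewrite edge_height_range//; apply/andP; split=> //; exact: ltW.
rewrite annulus_areaE; set Z := _ `&` unit_band.
have YP u : Y u <-> [/\ B (torus_proj (coord_plane k u)), a < u.1 < a + 1 &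
    1/4 <= u.2 <= 3/4].
  by rewrite /Y /= /setX/= !in_itv/=; split=> [[? []]|[]].
have ZP u : Z u <-> [/\ B (torus_proj (coord_plane k u)), 0 <= u.1 < 1 &
    1/4 <= u.2 <= 3/4].
  by rewrite /Z /unit_band /= /setX/= !in_itv/=; split=> [[? []]|[]].
have mZ : measurable Z.
  by apply: measurableI => //; exact: unit_band_measurable.
have mlt (b : R) : measurable ([set u | u.1 < b] : set plane).
  rewrite (_ : [set _ | _] = `]-oo, b[%classic `*` setT).
    by apply: measurableX => //; exact: measurable_itv.
  by apply/seteqP; split=> u /=; rewrite in_itv/= => // -[].
(* [Z] is cut at [a] and [Y] at 1; the upper part of [Z] is the lower part of
   [Y], and the other two pieces differ by a translation by 1. *)
rewrite (measureDI leb2 mZ (mlt a)) (measureDI leb2 mY (mlt 1)) addeC.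
congr (_ + _)%E; last first.
  congr (leb2 _); apply/seteqP; split=> u [] => [/ZP[Bu u1 u2] /negP|/YP[Bu u1 u2]].
    rewrite -leNgt => au.
    have [v [[[/= vI _] _] _ uv]] := inB _ Bu u2.
    have ua : u.1 != a.
      apply/eqP => ua; move: uv; rewrite ua => /int_abs_lt1 h.
      have : a - v.1 = 0.
        by apply: h; rewrite ltr_norml; case/andP: vI => ? ?; apply/andP; split; lra.
      by case/andP: vI => ? ?; lra.
    split; last by case/andP: u1.
    apply/YP; split=> //; rewrite lt_neqAle eq_sym ua au/=.
    by case/andP: u1 => ? ?; lra.
  move=> /= u11; case/andP: u1 => u1 u1'; split; last by apply/negP; rewrite -leNgt ltW.
  by apply/ZP; split=> //; rewrite u11 (le_trans a0 (ltW u1)).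
have mYh : measurable (Y `\` [set u : plane | u.1 < 1]) by exact: measurableD.
transitivity (leb2 ((fun u => (u.1 + 1, 1 * u.2 + 0)) @^-1`
    (Y `\` [set u : plane | u.1 < 1]))); last first.
  by apply: plane_lebesgue_isometry; rewrite ?expr1n.
congr (leb2 _).
have shift u : torus_proj (coord_plane k (u.1 + 1, u.2)) = torus_proj (coord_plane k u).
  apply/torus_proj_coord_planeP; rewrite coord_plane0 coord_plane1 coord_plane2/= subrr.
  by rewrite addrAC subrr add0r rpred0 rpred1.
apply/seteqP; split=> u; rewrite /preimage /= mul1r addr0.
  move=> [/ZP[Bu /andP[u0 _] u2] ua]; split; last by apply/negP; rewrite -leNgt /=; lra.
  by apply/YP; rewrite shift /=; split=> //; apply/andP; split; lra.
move=> [/YP[]]; rewrite shift /= => Bu /andP[ua ua'] u2 /negP; rewrite -leNgt => u1.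
split; last by lra.
by apply/ZP; split=> //; apply/andP; split; lra.
Qed.

(** A Borel set in the image of a chart of annulus [k] is not charged by the areas
    of the other annuli, and edge charts have density 1. *)
Lemma annuli_area_measure J : area_measure (annuli J) (annuli_area J).
Proof.
split.
  rewrite [LHS]annuli_areaE big1// => k kJ; apply: annulus_area_disjoint => p np kp.
  by apply: np; exists k.
move=> p [k kJ kp]; have [eps [a [u [e1 aI uD up]]]] := edge_chart_cover kp.
exists (edge_domain a), (edge_chart eps k); split.
- exact: edge_chart_local_param.
- by exists u.
move=> B mB Bim.
rewrite [LHS](annuli_area_annulus kJ); last first.
  move=> q /Bim[v [[_ v2] v0] <-]; exists (v.1, edge_height eps v.2).
    by rewrite /= edge_height_range//; apply/andP; split=> //; exact: ltW.
  by rewrite /= edge_chartE.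
rewrite (annulus_area_chart e1 aI mB Bim).
under eq_integral do rewrite area_density_edge_chart//.
rewrite integral_cst ?mul1e//.
apply: measurableI; last first.
  rewrite -[X in measurable X]setTI.
  apply: (@continuous_torus_measurable (@torus_proj R \o edge_chart eps k)) => //.
  move=> v; apply: continuous_comp; first exact: affine_map_continuous.
  exact: torus_proj_continuous.
apply: measurableI.
  by apply: open_plane_measurable; exact: edge_domain_open.
rewrite (_ : @half_plane R = setT `*` `[0, +oo[%classic).
  by apply: measurableX; [exact: measurableT|exact: measurable_itv].
by apply/seteqP; split=> v; rewrite /half_plane /= in_itv/= andbT => // -[].
Qed.

Lemma annuli_toral_surface J :
  toral_surface (annuli J) (annuli_area J) (@annuli_normal R).
Proof.
split.
- exact: annuli_compact.
- exact: annuli_regular.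
- exact: annuli_smooth_normal.
- exact: annuli_area_measure.
- by move=> p [k _ kp]; rewrite (annuli_normalE kp); exact: annuli_unit_normal.
Qed.

Lemma annuli_area_total J : annuli_area J (annuli J) = (#|J|%:R / 2)%:E.
Proof.
rewrite [LHS]annuli_areaE (eq_bigr (fun=> (1/2)%:E)) => [|k kJ].
  by rewrite sumEFin sumr_const; congr EFin; rewrite -[LHS]mulr_natl mul1r.
by apply: annulus_area_full => p kp; exists k.
Qed.

(** The moment matrix is diagonal, with the area of annulus [i + 1] in position
    [i]. *)
Lemma annuli_normal_moment J i j :
  \int[annuli_area J]_(p in annuli J)
    (annuli_normal p 0 i * annuli_normal p 0 j) =
  if (i == j) && (i + 1 \in J) then 1/2 else 0.
Proof.
have [<-|ij] := eqVneq i j; last first.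
  (* A point lies on at most one annulus, so its normal is a coordinate axis. *)
  rewrite /Rintegral integral0_eq// => p _; rewrite !mxE.
  case: (asboolP (annulus (i + 1) p)) => ip; last by rewrite memNset// mul0r.
  rewrite (@memNset _ (annulus (j + 1))) ?mulr0// => jp; case/eqP: ij.
  by apply: (addIr 1); exact: annulus_disjoint ip jp.
pose D : set (torus3_borel R) := annulus (i + 1).
have mD : measurable D by apply: torus_compact_measurable; exact: annulus_compact.
have mJ : measurable (annuli J : set (torus3_borel R)).
  by apply: torus_compact_measurable; exact: annuli_compact.
rewrite /Rintegral (eq_integral (fun p : torus3_borel R => (\1_D p)%:E)); last first.
  by move=> p _; rewrite !mxE indicE; case: (p \in _); rewrite ?mul1r ?mul0r.
rewrite integral_indic//= setIC; case: ifPn => iJ.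
  rewrite (_ : _ `&` _ = D); last by apply/setIidPr => p ip; exists (i + 1).
  by rewrite (annuli_area_annulus iJ)// annulus_area_full.
rewrite (_ : _ `&` _ = set0) ?measure0//.
rewrite -subset0 => p [[k kJ kp] ip]; move: iJ.
by rewrite (annulus_disjoint ip kp) => /negP.
Qed.

Lemma annuli_normal_integral J :
  normal_integral (annuli J) (annuli_area J) (@annuli_normal R) =
  (#|J|%:R / 4)%:E.
Proof.
rewrite (normal_integralE (annuli_toral_surface J)); congr EFin.
rewrite -(pair_bigA _ (fun i j => (\int[annuli_area J]_(p in annuli J)
  (annuli_normal p 0 i * annuli_normal p 0 j))%R ^+ 2))/=.
transitivity (\sum_(i : 'I_3) (if i + 1 \in J then 1/4 else 0 : R)).
  apply: eq_bigr => i _; rewrite (bigD1 i)//= big1 ?addr0 => [|j ji].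
    by rewrite annuli_normal_moment eqxx /=; case: ifP => _; rewrite ?expr0n//; lra.
  by rewrite annuli_normal_moment eq_sym (negPf ji) expr0n.
transitivity (\sum_(k : 'I_3) (if k \in J then 1/4 else 0 : R)).
  by rewrite [RHS](reindex_inj (addIr 1)).
by rewrite -big_mkcond/= sumr_const -[LHS]mulr_natl mul1r.
Qed.

End AnnuliArea.

(** * The sharp bounds *)

Theorem proposition1p4 (R : realType) :
  (forall (S : set (torus3 R))
      (sigma : {finite_measure set (torus3_borel R) -> \bar R})
      (n : torus3 R -> 'rV[R]_3) (A : R),
    toral_surface S sigma n -> sigma S = A%:E ->
    exists I : R,
      [/\ normal_integral S sigma n = I%:E,
          A ^+ 2 / 3 <= I <= A ^+ 2 &
          0 <= pi ^+ 2 / 60 * (3 * I - A ^+ 2) <= pi ^+ 2 / 30 * A ^+ 2]) /\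
  (forall c : R,
    (forall (S : set (torus3 R))
        (sigma : {finite_measure set (torus3_borel R) -> \bar R})
        (n : torus3 R -> 'rV[R]_3) (A I : R),
      toral_surface S sigma n -> sigma S = A%:E ->
      normal_integral S sigma n = I%:E -> c * A ^+ 2 <= I) ->
    c <= 1 / 3) /\
  (forall c : R,
    (forall (S : set (torus3 R))
        (sigma : {finite_measure set (torus3_borel R) -> \bar R})
        (n : torus3 R -> 'rV[R]_3) (A I : R),
      toral_surface S sigma n -> sigma S = A%:E ->
      normal_integral S sigma n = I%:E -> I <= c * A ^+ 2) ->
    1 <= c).
Proof.
split; [|split].
- move=> S sigma n A tS SA.
  have [I IE IA] := normal_integral_bounds tS SA.
  exists I; split=> //; case/andP: IA => IA1 IA2.
  have c0 : 0 <= pi ^+ 2 / 60 :> R by rewrite divr_ge0// sqr_ge0.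
  apply/andP; split; first by apply: mulr_ge0 => //; lra.
  rewrite (_ : pi ^+ 2 / 30 * A ^+ 2 = pi ^+ 2 / 60 * (2 * A ^+ 2)); last by field.
  by apply: ler_wpM2l => //; lra.
- (* All three annuli: A = 3/2 and I = 3/4. *)
  move=> c lb.
  have := lb _ _ _ _ _ (annuli_toral_surface R predT) (annuli_area_total R predT)
    (annuli_normal_integral R predT).
  by rewrite card_ord; lra.
- (* One annulus: A = 1/2 and I = 1/4. *)
  move=> c ub.
  have := ub _ _ _ _ _ (annuli_toral_surface R (pred1 0)) (annuli_area_total R (pred1 0))
    (annuli_normal_integral R (pred1 0)).
  by rewrite card1; lra.
Qed.
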